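(* Every semi-Nelson algebra $\mathbf{A}$ is isomorphic (as a semi-Nelson algebra) to an algebra of the form $\mathbf{N(H,F)}$ for some semi-Heyting algebra $\mathbf{H}$ and some $i$-filter $F$ of $\mathbf{H}$.
   Context: **Semi-Heyting algebra**: an algebra $\mathbf{H}=\langle H;\land,\lor,\Rightarrow,0,1\rangle$ of type $(2,2,2,0,0)$ such that $\langle H,\land,\lor,0,1\rangle$ is a bounded lattice and for all $x,y,z\in H$: $x\land(x\Rightarrow y)=x\land y$; $x\land(y\Rightarrow z)=x\land((x\land y)\Rightarrow(x\land z))$; $x\Rightarrow x=1$. Write $x^*=x\Rightarrow 0$ (this is the pseudocomplement of $x$). An element $x$ is dense if $x^*=0$; $\mathcal{D}_s(H)$ is the set of dense elements of $H$. **Semi-Nelson algebra**: an algebra $\mathbf{A}=\langle A;\land,\lor,\to,\sim,1\rangle$ of type $(2,2,2,1,0)$ such that, writing $x\to_N y:=x\to(x\land y)$, for all $x,y,z\in A$: (SN1) $x\land(x\lor y)=x$; (SN2) $x\land(y\lor z)=(z\land x)\lor(y\land x)$; (SN3) $\sim\sim x=x$; (SN4) $\sim(x\land y)=\sim x\lor\sim y$; (SN5) $x\land\sim x=(x\land\sim x)\land(y\lor\sim y)$; (SN6) $x\land(x\to_N y)=x\land(\sim x\lor y)$; (SN7) $x\to_N(y\to_N z)=(x\land y)\to_N z$; (SN8) $(x\to_N y)\to_N[(y\to_N x)\to_N[(x\to z)\to_N(y\to z)]]=1$; (SN9) $(x\to_N y)\to_N[(y\to_N x)\to_N[(z\to x)\to_N(z\to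 y)]]=1$; (SN10) $(\sim(x\to y))\to_N(x\land\sim y)=1$; (SN11) $(x\land\sim y)\to_N(\sim(x\to y))=1$. **$i$-filter**: a subset $F\subseteq H$ of a semi-Heyting algebra $\mathbf{H}$ such that (IF1) $F$ is a lattice filter of $\mathbf{H}$; (IF2) $\mathcal{D}_s(H)\subseteq F$; (IF3) whenever $z,t\in H$ and $z\lor t\in F$, then for all $x\in H$, $(x\Rightarrow z)\lor(x\land t)\in F$. **The algebra $\mathbf{N(H,F)}$**: for a semi-Heyting algebra $\mathbf{H}$ and an $i$-filter $F$, $N(H,F)=\{(a,b)\in H^2: a\land b=0,\ a\lor b\in F\}$, and $\mathbf{N(H,F)}=\langle N(H,F);\sqcap,\sqcup,\to,\sim,\top\rangle$ with $(a,b)\sqcap(c,d)=(a\land c,b\lor d)$, $(a,b)\sqcup(c,d)=(a\lor c,b\land d)$, $(a,b)\to(c,d)=(a\Rightarrow c,a\land d)$, $\sim(a,b)=(b,a)$, $\top=(1,0)$. *)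

(* Defs.v *)
From HB Require Import structures.
From mathcomp Require Import all_boot all_order.
From mathcomp Require Import boolp classical_sets.

Set Implicit Arguments.
Unset Strict Implicit.
Unset Printing Implicit Defensive.

Import Order.TTheory.
Local Open Scope order_scope.

Reserved Notation "x ⇒ y" (at level 55, right associativity).
Reserved Notation "x ⊓ y" (at level 40, left associativity).
Reserved Notation "x ⊔ y" (at level 50, left associativity).
Reserved Notation "x ⟶ y" (at level 55, right associativity).
Reserved Notation "x ⟶N y" (at level 55, right associativity).
Reserved Notation "∼ x" (at level 35, right associativity).

(* Distributivity of the lattice is a consequence of the axioms, see
   [sh_meetUr] below.  As every MathComp lattice, the carrier is a choiceType;
   classically every type is one. *)
HB.mixin Record isSemiHeyting (d : Order.disp_t) H of Order.TBLattice d H := {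
  shimp : H -> H -> H;
  shimp_mp : forall x y : H, x `&` shimp x y = x `&` y;
  shimp_meet : forall x y z : H,
    x `&` shimp y z = x `&` shimp (x `&` y) (x `&` z);
  shimpxx : forall x : H, shimp x x = \top
}.

#[short(type="semiHeytingType")]
HB.structure Definition SemiHeyting (d : Order.disp_t) :=
  { H of isSemiHeyting d H & Order.TBLattice d H }.

Declare Scope sh_scope.
Delimit Scope sh_scope with SH.
Notation "x ⇒ y" := (shimp x y) : sh_scope.
Local Open Scope sh_scope.

Section SemiHeytingFilters.
Variables (d : Order.disp_t) (H : semiHeytingType d).
Implicit Types (x y z t : H) (F : set H).

Definition pseudocompl x : H := x ⇒ \bot.

Definition dense_elements : set H := [set x | pseudocompl x = \bot].

Definition lattice_filter F : Prop :=
  [/\ exists x, F x,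
      forall x y, F x -> F y -> F (x `&` y)
    & forall x y, F x -> x <= y -> F y].

Definition is_ifilter F : Prop :=
  [/\ lattice_filter F,
      (dense_elements `<=` F)%classic
    & forall z t, F (z `|` t) -> forall x, F ((x ⇒ z) `|` (x `&` t))].

Record ifilter := IFilter {
  ifilter_set : set H;
  ifilter_prop : is_ifilter ifilter_set
}.

End SemiHeytingFilters.

HB.mixin Record hasSemiNelsonOps A := {
  snmeet : A -> A -> A;
  snjoin : A -> A -> A;
  snimp : A -> A -> A;
  snneg : A -> A;
  sntop : A
}.

(* Algebras of type (2,2,2,1,0), without any axiom. *)
#[short(type="semiNelsonSigType")]
HB.structure Definition SemiNelsonSig := { A of hasSemiNelsonOps A }.

Arguments sntop {_}.

Declare Scope sn_scope.
Delimit Scope sn_scope with SN.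
Notation "x ⊓ y" := (snmeet x y) : sn_scope.
Notation "x ⊔ y" := (snjoin x y) : sn_scope.
Notation "x ⟶ y" := (snimp x y) : sn_scope.
Notation "∼ x" := (snneg x) : sn_scope.
Local Open Scope sn_scope.

Definition snimpN (A : semiNelsonSigType) (x y : A) : A := x ⟶ (x ⊓ y).
Notation "x ⟶N y" := (snimpN x y) : sn_scope.

HB.mixin Record isSemiNelson A of SemiNelsonSig A := {
  SN1 : forall x y : A, x ⊓ (x ⊔ y) = x;
  SN2 : forall x y z : A, x ⊓ (y ⊔ z) = (z ⊓ x) ⊔ (y ⊓ x);
  SN3 : forall x : A, ∼ ∼ x = x;
  SN4 : forall x y : A, ∼ (x ⊓ y) = ∼ x ⊔ ∼ y;
  SN5 : forall x y : A, x ⊓ ∼ x = (x ⊓ ∼ x) ⊓ (y ⊔ ∼ y);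
  SN6 : forall x y : A, x ⊓ (x ⟶N y) = x ⊓ (∼ x ⊔ y);
  SN7 : forall x y z : A, x ⟶N (y ⟶N z) = (x ⊓ y) ⟶N z;
  SN8 : forall x y z : A,
    (x ⟶N y) ⟶N ((y ⟶N x) ⟶N ((x ⟶ z) ⟶N (y ⟶ z))) = sntop;
  SN9 : forall x y z : A,
    (x ⟶N y) ⟶N ((y ⟶N x) ⟶N ((z ⟶ x) ⟶N (z ⟶ y))) = sntop;
  SN10 : forall x y : A, (∼ (x ⟶ y)) ⟶N (x ⊓ ∼ y) = sntop;
  SN11 : forall x y : A, (x ⊓ ∼ y) ⟶N (∼ (x ⟶ y)) = sntop
}.

#[short(type="semiNelsonType")]
HB.structure Definition SemiNelson :=
  { A of isSemiNelson A & SemiNelsonSig A }.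

Definition sn_morphism (A B : semiNelsonSigType) (f : A -> B) : Prop :=
  [/\ {morph f : x y / x ⊓ y}, {morph f : x y / x ⊔ y},
      {morph f : x y / x ⟶ y}, {morph f : x / ∼ x}
    & f sntop = sntop].

Definition sn_isomorphic (A B : semiNelsonType) : Prop :=
  exists2 f : A -> B, sn_morphism f & bijective f.

Section SemiHeytingTheory.
Variables (d : Order.disp_t) (H : semiHeytingType d).
Implicit Types x y z : H.

(* [x ⇒ x `&` y] is the relative pseudocomplement of x with respect to y. *)
Lemma sh_residuation x y z : (z <= x ⇒ (x `&` y)) = (z `&` x <= y).
Proof.
apply/idP/idP => [le_z|le_y].
  have : x `&` z <= x `&` (x ⇒ (x `&` y)) by rewrite leI2.
  by rewrite shimp_mp meetA meetxx meetC lexI => /andP[].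
by rewrite leEmeet shimp_meet meetA (meet_l le_y) shimpxx meetx1.
Qed.

Lemma sh_meetUr x y z : x `&` (y `|` z) = (x `&` y) `|` (x `&` z).
Proof.
apply/le_anti/andP; split; last by rewrite leUx !leI2 ?leUl ?leUr.
rewrite meetC -sh_residuation leUx !sh_residuation.
by rewrite (meetC y) (meetC z) leUl leUr.
Qed.

Lemma sh_meetUl x y z : (y `|` z) `&` x = (y `&` x) `|` (z `&` x).
Proof. by rewrite meetC sh_meetUr !(meetC x). Qed.

Lemma sh_joinIr x y z : x `|` (y `&` z) = (x `|` y) `&` (x `|` z).
Proof.
apply/le_anti/andP; split.
  by rewrite lexI !leUx !leUl /= !(le_trans _ (leUr _ _)) ?leIl ?leIr.
rewrite sh_meetUl leUx (le_trans (leIl _ _) (leUl _ _)) /= sh_meetUr leUx.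
by rewrite (le_trans (leIr _ _) (leUl _ _)) leUr.
Qed.

Lemma sh_meetU_disj x y z : x `&` y = \bot -> x `&` (y `|` z) = x `&` z.
Proof. by move=> xy0; rewrite sh_meetUr xy0 join0x. Qed.

Lemma shimp_elim x y : x `&` (x ⇒ y) <= y.
Proof. by rewrite shimp_mp leIr. Qed.

Lemma shimp_curry x y z :
  x ⇒ (x `&` (y ⇒ (y `&` z))) = (x `&` y) ⇒ ((x `&` y) `&` z).
Proof.
apply/le_anti/andP; split.
  by rewrite sh_residuation meetA -sh_residuation -sh_residuation.
by rewrite !sh_residuation -meetA -sh_residuation.
Qed.

Lemma shimp_congr k x y u v :
  k `&` x = k `&` y -> k `&` u = k `&` v -> k `&` (x ⇒ u) <= y ⇒ v.
Proof. by move=> xy uv; rewrite shimp_meet xy uv -shimp_meet leIr. Qed.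

Lemma shimpN_congr x y : let k := (x ⇒ (x `&` y)) `&` (y ⇒ (y `&` x)) in
  k `&` x = k `&` y.
Proof.
move=> k; have kxy : k `&` x <= y by rewrite -sh_residuation leIl.
have kyx : k `&` y <= x by rewrite -sh_residuation leIr.
by clearbody k; apply/le_anti; rewrite !lexI !leIl kxy kyx.
Qed.

End SemiHeytingTheory.

Section NelsonConstruction.
Variables (d : Order.disp_t) (H : semiHeytingType d) (F : ifilter H).
Implicit Types p q : H * H.

Definition nelson_set : set (H * H) :=
  [set p | p.1 `&` p.2 = \bot /\ ifilter_set F (p.1 `|` p.2)].

Definition nelson_alg : Type := set_type nelson_set.

Lemma ifilter_le x y : ifilter_set F x -> x <= y -> ifilter_set F y.
Proof. by case: (ifilter_prop F) => -[_ _ Fle] _ _; apply: Fle. Qed.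

Lemma ifilter_meet x y :
  ifilter_set F x -> ifilter_set F y -> ifilter_set F (x `&` y).
Proof. by case: (ifilter_prop F) => -[_ FI _] _ _; apply: FI. Qed.

Lemma ifilter_top : ifilter_set F \top.
Proof.
by case: (ifilter_prop F) => -[[x Fx] _ _] _ _; apply: ifilter_le (lex1 x).
Qed.

Lemma nelson_neg_subproof p : nelson_set p -> nelson_set (p.2, p.1).
Proof. by case=> p0 Fp; split; rewrite /= 1?meetC 1?joinC. Qed.

Lemma nelson_meet_subproof p q : nelson_set p -> nelson_set q ->
  nelson_set (p.1 `&` q.1, p.2 `|` q.2).
Proof.
case: p q => [a b] [a' b'] [/= ab Fab] [/= ab' Fab']; split=> /=.
  by rewrite sh_meetUr meetAC ab meet0x -meetA ab' meetx0 joinxx.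
apply: ifilter_le (ifilter_meet Fab Fab') _.
rewrite [leRHS]joinC sh_joinIr leI2 //.
  by rewrite leUx leUr /= (le_trans (leUl b b')) ?leUl.
by rewrite leUx leUr /= (le_trans (leUr b' b)) ?leUl.
Qed.

Lemma nelson_join_subproof p q : nelson_set p -> nelson_set q ->
  nelson_set (p.1 `|` q.1, p.2 `&` q.2).
Proof.
move=> /nelson_neg_subproof Np /nelson_neg_subproof Nq.
exact: nelson_neg_subproof (nelson_meet_subproof Np Nq).
Qed.

Lemma nelson_imp_subproof p q : nelson_set p -> nelson_set q ->
  nelson_set (p.1 ⇒ q.1, p.1 `&` q.2).
Proof.
case: p q => [a b] [a' b'] [/= _ _] [/= ab' Fab']; split=> /=.
  by rewrite meetA [_ `&` a]meetC shimp_mp -meetA ab' meetx0.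
by case: (ifilter_prop F) => _ _; apply.
Qed.

Lemma nelson_top_subproof : nelson_set (\top, \bot).
Proof. by split; rewrite /= ?meetx0 // joinx0; apply: ifilter_top. Qed.

Definition nelson_meet (x y : nelson_alg) : nelson_alg :=
  SigSub (mem_set (nelson_meet_subproof (set_valP x) (set_valP y))).
Definition nelson_join (x y : nelson_alg) : nelson_alg :=
  SigSub (mem_set (nelson_join_subproof (set_valP x) (set_valP y))).
Definition nelson_imp (x y : nelson_alg) : nelson_alg :=
  SigSub (mem_set (nelson_imp_subproof (set_valP x) (set_valP y))).
Definition nelson_neg (x : nelson_alg) : nelson_alg :=
  SigSub (mem_set (nelson_neg_subproof (set_valP x))).
Definition nelson_top : nelson_alg := SigSub (mem_set nelson_top_subproof).

HB.instance Definition _ := hasSemiNelsonOps.Build nelson_alg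
  nelson_meet nelson_join nelson_imp nelson_neg nelson_top.

Implicit Types x y z : nelson_alg.

Lemma nelson_eq x y :
  (val x).1 = (val y).1 -> (val x).2 = (val y).2 -> x = y.
Proof.
move=> e1 e2; apply: val_inj.
by rewrite [LHS]surjective_pairing [RHS]surjective_pairing e1 e2.
Qed.

Lemma nelson_disj x : (val x).1 `&` (val x).2 = \bot.
Proof. by case: (set_valP x). Qed.

Lemma nelson_impNE2 x y : (val (x ⟶N y)).2 = (val x).1 `&` (val y).2.
Proof. exact/sh_meetU_disj/nelson_disj. Qed.

Lemma nelson_impN_top x y : (val x).1 <= (val y).1 ->
  (val x).1 `&` (val y).2 = \bot -> x ⟶N y = sntop.
Proof.
move=> le1 disj; apply: nelson_eq; last by rewrite nelson_impNE2.
by rewrite /= (meet_l le1) shimpxx.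
Qed.

Lemma nelson_SN1 x y : x ⊓ (x ⊔ y) = x.
Proof. by apply: nelson_eq; rewrite /= ?joinKI ?meetKU. Qed.

Lemma nelson_SN2 x y z : x ⊓ (y ⊔ z) = (z ⊓ x) ⊔ (y ⊓ x).
Proof.
apply: nelson_eq => /=.
  by rewrite joinC -sh_meetUl meetC.
by rewrite meetC !(joinC _ (val x).2) sh_joinIr.
Qed.

Lemma nelson_SN3 x : ∼ ∼ x = x.
Proof. exact: nelson_eq. Qed.

Lemma nelson_SN4 x y : ∼ (x ⊓ y) = ∼ x ⊔ ∼ y.
Proof. exact: nelson_eq. Qed.

Lemma nelson_SN5 x y : x ⊓ ∼ x = (x ⊓ ∼ x) ⊓ (y ⊔ ∼ y).
Proof.
apply: nelson_eq => /=; first by rewrite nelson_disj meet0x.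
by rewrite [(val y).2 `&` _]meetC nelson_disj joinx0.
Qed.

Lemma nelson_SN6 x y : x ⊓ (x ⟶N y) = x ⊓ (∼ x ⊔ y).
Proof.
apply: nelson_eq => /=; last by rewrite (sh_meetU_disj _ (nelson_disj x)).
by rewrite shimp_mp meetA meetxx (sh_meetU_disj _ (nelson_disj x)).
Qed.

Lemma nelson_SN7 x y z : x ⟶N (y ⟶N z) = (x ⊓ y) ⟶N z.
Proof.
apply: nelson_eq; first exact: shimp_curry.
by rewrite !nelson_impNE2 /= meetA.
Qed.

Lemma nelson_SN8 x y z :
  (x ⟶N y) ⟶N ((y ⟶N x) ⟶N ((x ⟶ z) ⟶N (y ⟶ z))) = sntop.
Proof.
rewrite !nelson_SN7; have := shimpN_congr (val x).1 (val y).1.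
set k := _ `&` _ => kxy; apply: nelson_impN_top => /=; rewrite -/k.
  exact: shimp_congr.
apply/eqP; rewrite -lex0 -(nelson_disj z) meetA leI2 // meetAC -kxy.
by rewrite -meetA (le_trans (leIr _ _)) ?shimp_elim.
Qed.

Lemma nelson_SN9 x y z :
  (x ⟶N y) ⟶N ((y ⟶N x) ⟶N ((z ⟶ x) ⟶N (z ⟶ y))) = sntop.
Proof.
rewrite !nelson_SN7; have := shimpN_congr (val x).1 (val y).1.
set k := _ `&` _ => kxy; apply: nelson_impN_top => /=; rewrite -/k.
  exact: shimp_congr.
apply/eqP; rewrite -lex0 -(nelson_disj y) meetA leI2 //.
rewrite -meetA [_ `&` (val z).1]meetC shimp_mp meetCA kxy.
by rewrite meetA leIr.
Qed.

Lemma nelson_SN10 x y : (∼ (x ⟶ y)) ⟶N (x ⊓ ∼ y) = sntop.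
Proof.
apply: nelson_impN_top => //=.
by rewrite sh_meetUr meetAC nelson_disj meet0x join0x -meetA
  [(val y).2 `&` _]meetC nelson_disj meetx0.
Qed.

Lemma nelson_SN11 x y : (x ⊓ ∼ y) ⟶N (∼ (x ⟶ y)) = sntop.
Proof.
apply: nelson_impN_top => //=.
by rewrite meetAC shimp_mp -meetA nelson_disj meetx0.
Qed.

HB.instance Definition _ := isSemiNelson.Build nelson_alg
  nelson_SN1 nelson_SN2 nelson_SN3 nelson_SN4 nelson_SN5 nelson_SN6
  nelson_SN7 nelson_SN8 nelson_SN9 nelson_SN10 nelson_SN11.

End NelsonConstruction.

(* Main.v *)
(* The relation x ⟶N y = 1 on A turns out to mean x <= ∼ x ⊔ y, a preorder
   whose symmetric part is a congruence for ⊓, ⊔ and ⟶ (not for ∼).  The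
   quotient H is a semi-Heyting algebra, x |-> ([x], [∼ x]) is an embedding
   because x <= y as soon as [x] <= [y] and [∼ y] <= [∼ x], and F is the up-set
   generated by the classes [x ⊔ ∼ x].  The case p `&` q != 0 of (IF3), for
   p `|` q in F, reduces to the disjoint one by replacing q with q `&` p^*,
   since p `|` p^* is dense. *)

Require Import Defs.
From HB Require Import structures.
From mathcomp Require Import all_boot all_order.
From mathcomp Require Import boolp classical_sets.

Set Implicit Arguments.
Unset Strict Implicit.
Unset Printing Implicit Defensive.

Import Order.TTheory.
Local Open Scope order_scope.
Local Open Scope sn_scope.
Local Open Scope quotient_scope.

(** * Lattice identities from Sholander's axioms SN1, SN2 and the De Morgan involution *)

Section SholanderLattice.
Variable A : semiNelsonType.
Implicit Types x y z : A.

(** SN1 and SN2 give [y = (y ⊓ y) ⊔ (y ⊓ y)] for every [y]. Expanding the second factor of [x ⊓ x]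
    this way leaves only copies of [(x ⊓ x) ⊓ x], which SN1 collapses to [x ⊓ x]. *)
Lemma snmeetxx x : x ⊓ x = x.
Proof.
have dbl y : y = (y ⊓ y) ⊔ (y ⊓ y) by rewrite -SN2 SN1.
have xxx : (x ⊓ x) ⊓ x = x ⊓ x by have := SN1 (x ⊓ x) (x ⊓ x); rewrite -dbl.
by rewrite {2}(dbl x) SN2 xxx -dbl.
Qed.

Lemma snjoinxx x : x ⊔ x = x.
Proof. by rewrite -{1 2}(snmeetxx x) -SN2 SN1. Qed.

(** SN2 swaps the factors while distributing; on [y ⊔ y] only the swap remains. *)
Lemma snmeetC x y : x ⊓ y = y ⊓ x.
Proof. by rewrite -{1}(snjoinxx y) SN2 snjoinxx. Qed.

Lemma snnegU x y : ∼ (x ⊔ y) = ∼ x ⊓ ∼ y.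
Proof. by rewrite -[RHS]SN3 SN4 !SN3. Qed.

Lemma snjoinC x y : x ⊔ y = y ⊔ x.
Proof. by rewrite -[LHS]SN3 snnegU snmeetC -snnegU SN3. Qed.

Lemma snmeetUr x y z : x ⊓ (y ⊔ z) = (x ⊓ y) ⊔ (x ⊓ z).
Proof. by rewrite SN2 snjoinC !(snmeetC x). Qed.

Lemma snjoinIr x y z : x ⊔ (y ⊓ z) = (x ⊔ y) ⊓ (x ⊔ z).
Proof.
rewrite -[LHS]SN3 snnegU [∼ (y ⊓ z)]SN4 (snmeetUr (∼ x)).
by rewrite -!snnegU -SN4 SN3.
Qed.

Lemma snmeetKU x y : x ⊔ (x ⊓ y) = x.
Proof. by rewrite -[LHS]SN3 snnegU [∼ (x ⊓ y)]SN4 SN1 SN3. Qed.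

Lemma snmeet_join x y : (x ⊓ y = x) <-> (x ⊔ y = y).
Proof.
by split=> <-; [rewrite snjoinC snmeetC snmeetKU | rewrite SN1].
Qed.

(** Put [e = x ⟶N x]. SN8 at [x, x, x], collapsed by SN7, gives [e ⟶N e = sntop]. Since [x ⊓ e = x],
    SN7 also reduces [e ⟶N e] to [x ⟶N x]. *)
Lemma snimpNxx x : x ⟶N x = sntop.
Proof.
have xe : x ⊓ (x ⟶N x) = x by rewrite SN6 snjoinC SN1.
have ee1 : (x ⟶N x) ⟶N (x ⟶N x) = sntop.
  have impxx : x ⟶ x = x ⟶N x by rewrite /snimpN snmeetxx.
  by rewrite -(SN8 x x x) impxx !SN7 !snmeetxx.
by rewrite -[RHS]ee1 SN7 snmeetC xe.
Qed.

End SholanderLattice.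

(* A copy of the carrier, made a choiceType classically so as to bear an
   order. *)
Definition sn_lattice (A : semiNelsonType) : Type := {classic A}.

HB.instance Definition _ (A : semiNelsonType) :=
  Choice.copy (sn_lattice A) {classic A}.
HB.instance Definition _ (A : semiNelsonType) :=
  SemiNelson.copy (sn_lattice A) A.

Fact sn_display : Order.disp_t. Proof. exact: Order.Disp tt tt. Qed.

(** * The bounded distributive lattice of a semi-Nelson algebra *)

Section LatticeInstance.
Variable A : semiNelsonType.
Implicit Types x y z : sn_lattice A.

Definition sn_le : rel (sn_lattice A) := fun x y => x ⊓ y == x.

Lemma sn_le_refl : reflexive sn_le.
Proof. by move=> x; apply/eqP/snmeetxx. Qed.

Lemma sn_le_anti : antisymmetric sn_le.
Proof. by move=> x y /andP[/eqP + /eqP]; rewrite snmeetC => -> ->. Qed.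

Lemma sn_le_trans : transitive sn_le.
Proof.
move=> y x z /eqP xy /eqP/snmeet_join yz.
by apply/eqP; rewrite -yz snmeetUr xy snmeetKU.
Qed.

HB.instance Definition _ := Order.Le_isPOrder.Build sn_display (sn_lattice A)
  sn_le_refl sn_le_anti sn_le_trans.

Lemma sn_lexI x y z : (x <= y ⊓ z) = (x <= y) && (x <= z).
Proof.
apply/idP/andP => [xyz|[/eqP/snmeet_join xy /eqP/snmeet_join xz]].
  split; apply: le_trans xyz _; apply/eqP/snmeet_join.
    by rewrite snjoinC snmeetKU.
  by rewrite snjoinC snmeetC snmeetKU.
by apply/eqP/snmeet_join; rewrite snjoinIr xy xz.
Qed.

Lemma sn_leUx x y z : (x ⊔ y <= z) = (x <= z) && (y <= z).
Proof.
apply/idP/andP => [xyz|[/eqP xz /eqP yz]].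
  split; apply: le_trans xyz; apply/eqP; rewrite ?SN1 //.
  by rewrite snjoinC SN1.
by apply/eqP; rewrite snmeetC snmeetUr !(snmeetC z) xz yz.
Qed.

HB.instance Definition _ := Order.POrder_isMeetSemilattice.Build sn_display
  (sn_lattice A) sn_lexI.
HB.instance Definition _ := Order.POrder_isJoinSemilattice.Build sn_display
  (sn_lattice A) sn_leUx.

Lemma sn_meetUl : @left_distributive (sn_lattice A) _ Order.meet Order.join.
Proof.
by move=> x y z; rewrite meetC [LHS]snmeetUr; congr (_ `|` _); apply: meetC.
Qed.

HB.instance Definition _ :=
  Order.Lattice_Meet_isDistrLattice.Build sn_display (sn_lattice A) sn_meetUl.

Lemma sn_lex1 x : x <= sntop.
Proof.
by apply/eqP; rewrite -(snimpNxx x) SN6 snjoinC SN1.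
Qed.

HB.instance Definition _ := Order.hasTop.Build sn_display (sn_lattice A)
  sn_lex1.

Lemma sn_le0x x : (∼ sntop : sn_lattice A) <= x.
Proof.
apply/eqP; rewrite -[LHS]SN3 SN4 SN3; congr snneg.
exact: (@join1x _ (sn_lattice A)).
Qed.

HB.instance Definition _ := Order.hasBottom.Build sn_display (sn_lattice A)
  sn_le0x.

End LatticeInstance.

(** * The preorder given by [⟶N], and its compatibility with the operations *)

Section NelsonPreorder.
Variable A : semiNelsonType.
Local Notation L := (sn_lattice A).
Implicit Types k u v x y z a b c : L.

Lemma sn_negI x y : ∼ (x `&` y) = (∼ x : L) `|` ∼ y.
Proof. exact: SN4. Qed.

Lemma sn_negU x y : ∼ (x `|` y) = (∼ x : L) `&` ∼ y.
Proof. exact: snnegU. Qed.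

Lemma sn_neg0 : ∼ (\bot : L) = \top.
Proof. exact: SN3. Qed.

Lemma sn_leN x y : ((∼ x : L) <= ∼ y) = (y <= x).
Proof.
have leN (u v : L) : u <= v -> (∼ v : L) <= ∼ u.
  by move=> /join_r uv; rewrite -uv sn_negU leIl.
by apply/idP/idP => /leN; rewrite ?SN3.
Qed.

Lemma sn_kleene x y : x `&` (∼ x : L) <= y `|` (∼ y : L).
Proof. by rewrite leEmeet; apply/eqP/esym/SN5. Qed.

Definition sn_qle x y := x <= (∼ x : L) `|` y.

(* On N(H,F) this relation compares first components. *)
Lemma sn_qleP x y : reflect (x ⟶N y = sntop) (sn_qle x y).
Proof.
have impN_le (u v : L) : u <= v -> u ⟶N v = sntop.
  move=> /meet_l uv; rewrite -[RHS](snimpNxx u) /snimpN snmeetxx.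
  by congr (_ ⟶ _).
apply: (iffP idP) => [/impN_le <-|xy].
  (* By SN6, [x ⟶N (x ⟶N y)] and [x ⟶N (∼ x ⊔ y)] unfold to the same implication, and SN7 contracts
     the former to [x ⟶N y]. *)
  rewrite -[LHS](_ : x ⟶N (x ⟶N y) = _); last by rewrite SN7 snmeetxx.
  by congr (_ ⟶ _); apply: SN6.
by rewrite /sn_qle leEmeet -[eqbLHS]SN6 xy [eqbLHS]meetx1.
Qed.

Lemma sn_qleN x y : sn_qle x y = (x `&` (∼ y : L) <= ∼ x).
Proof. by rewrite /sn_qle -sn_leN sn_negU SN3. Qed.

Lemma sn_le_qle x y : x <= y -> sn_qle x y.
Proof. by move=> xy; apply: le_trans xy (leUr _ _). Qed.

Lemma sn_qle_refl : reflexive sn_qle.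
Proof. by move=> x; apply: sn_le_qle. Qed.

(** Up to [∼ x], [x] is [x ⊓ y], which lies below [(x ⊓ ∼ y) ⊔ (x ⊓ z)]; the contrapositive of the
    first hypothesis puts [x ⊓ ∼ y] below [∼ x]. *)
Lemma sn_qle_trans : transitive sn_qle.
Proof.
move=> y x z xy yz; rewrite /sn_qle -{1}(meet_l xy) meetUr leUx.
rewrite (le_trans (leIr _ _) (leUl _ _)) (le_trans (leI2 (lexx x) yz)) //.
by rewrite meetUr leU2 ?leIr // -sn_qleN.
Qed.

Lemma sn_qleI z x y : sn_qle z (x `&` y) = sn_qle z x && sn_qle z y.
Proof. by rewrite /sn_qle joinIr lexI. Qed.

Lemma sn_qleU x y z : sn_qle (x `|` y) z = sn_qle x z && sn_qle y z.
Proof.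
apply/idP/andP => [xyz|[]].
  by split; apply: sn_qle_trans xyz; apply: sn_le_qle; rewrite ?leUl ?leUr.
(* The contraposed hypotheses bound only the diagonal terms. For a mixed term, Kleene's inequality
   passes from [u ⊓ ∼ u] to [v ⊔ ∼ v]. *)
have cross (u v : L) : u `&` (∼ z : L) <= ∼ u -> v `&` (∼ z : L) <= ∼ v ->
    u `&` (∼ z : L) <= ∼ v.
  move=> uz vz; apply: le_trans (_ : (v `|` (∼ v : L)) `&` (∼ z : L) <= _).
    rewrite lexI leIr andbT (le_trans _ (sn_kleene u v)) //.
    by rewrite lexI leIl uz.
  by rewrite meetUl leUx vz leIl.
rewrite !sn_qleN sn_negU meetUl leUx !lexI => xz yz.
by rewrite xz yz (cross x y) ?(cross y x).
Qed.

Lemma sn_qle_impN k x y : sn_qle k (x ⟶N y) = sn_qle (k `&` x) y.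
Proof. by apply/sn_qleP/sn_qleP; rewrite SN7. Qed.

Lemma sn_qle_kleene x : sn_qle (x `&` (∼ x : L)) \bot.
Proof.
by rewrite /sn_qle joinx0 sn_negI SN3 (le_trans (leIl _ _) (leUr _ _)).
Qed.

Lemma sn_qle_neg0 x : (∼ x : L) <= x -> sn_qle (∼ x) \bot.
Proof. by rewrite /sn_qle joinx0 SN3. Qed.

(** The first hypothesis and Kleene's inequality give [x <= y ⊔ ∼ y]; the second, contraposed,
    absorbs the part [x ⊓ ∼ y] into [y]. *)
Lemma sn_le_of_qle x y : sn_qle x y -> sn_qle (∼ y) (∼ x) -> x <= y.
Proof.
rewrite [sn_qle (∼ y) _]sn_qleN !SN3 meetC => xy yx.
have xyy : x <= y `|` (∼ y : L).
  apply: le_trans (_ : (x `&` (∼ x : L)) `|` y <= _); last first.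
    by rewrite leUx leUl sn_kleene.
  by rewrite joinIl lexI leUl.
by rewrite -(meet_l xyy) meetUr leUx leIr.
Qed.

(** SN8 curried by SN7, in a context [k]: congruence of [⟶] is the case [k = \top], while the
    semi-Heyting axioms need replacement of equals below an arbitrary element. *)
Lemma sn_qle_mono_impl k a b c : sn_qle (k `&` a) b -> sn_qle (k `&` b) a ->
  sn_qle (k `&` (a ⟶ c : L)) (b ⟶ c).
Proof.
rewrite -!sn_qle_impN => kab kba.
have := SN8 a b c; rewrite !SN7 => /sn_qleP abc.
have kabab : sn_qle k ((a ⟶N b : L) `&` (b ⟶N a)) by rewrite sn_qleI kab.
by apply: sn_qle_trans kabab _; rewrite sn_qle_impN.
Qed.

Lemma sn_qle_mono_impr k a b c : sn_qle (k `&` a) b -> sn_qle (k `&` b) a ->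
  sn_qle (k `&` (c ⟶ a : L)) (c ⟶ b).
Proof.
rewrite -!sn_qle_impN => kab kba.
have := SN9 a b c; rewrite !SN7 => /sn_qleP abc.
have kabab : sn_qle k ((a ⟶N b : L) `&` (b ⟶N a)) by rewrite sn_qleI kab.
by apply: sn_qle_trans kabab _; rewrite sn_qle_impN.
Qed.

Lemma sn_qle_mp x y : sn_qle (x `&` (x ⟶N y : L)) y.
Proof. by rewrite meetC -sn_qle_impN; apply: sn_qle_refl. Qed.

Lemma sn_neg_imp x y : sn_qle (∼ (x ⟶ y)) (x `&` (∼ y : L)) &&
  sn_qle (x `&` (∼ y : L)) (∼ (x ⟶ y)).
Proof. by apply/andP; split; apply/sn_qleP; [apply: SN10|apply: SN11]. Qed.

End NelsonPreorder.

(** * The semi-Heyting algebra of equivalence classes *)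

Section Quotient.
Variable A : semiNelsonType.
Local Notation L := (sn_lattice A).
Implicit Types k x y z a b c : L.

Definition sn_equiv x y := sn_qle x y && sn_qle y x.

Lemma sn_equiv_refl : reflexive sn_equiv.
Proof. by move=> x; rewrite /sn_equiv sn_qle_refl. Qed.

Lemma sn_equiv_sym : symmetric sn_equiv.
Proof. by move=> x y; rewrite /sn_equiv andbC. Qed.

Lemma sn_equiv_trans : transitive sn_equiv.
Proof.
move=> y x z /andP[xy yx] /andP[yz zy].
by rewrite /sn_equiv (sn_qle_trans xy yz) (sn_qle_trans zy yx).
Qed.

Canonical sn_equiv_rel :=
  EquivRel sn_equiv sn_equiv_refl sn_equiv_sym sn_equiv_trans.

Definition sn_quot : Type := {eq_quot sn_equiv_rel}.

HB.instance Definition _ := Choice.on sn_quot.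
HB.instance Definition _ := EqQuotient.on sn_quot.

Implicit Types p q r : sn_quot.

Definition sn_cls x : sn_quot := \pi x.

Lemma sn_clsP x y : sn_cls x = sn_cls y <-> sn_equiv x y.
Proof. by split=> [/eqmodP|xy] //; apply/eqmodP. Qed.

Lemma sn_cls_repr p : sn_cls (repr p) = p.
Proof. exact: reprK. Qed.

Lemma sn_cls_ind (P : sn_quot -> Prop) :
  (forall x, P (sn_cls x)) -> forall p, P p.
Proof. by move=> Pcls p; rewrite -(sn_cls_repr p). Qed.

Lemma sn_repr_cls x : sn_equiv (repr (sn_cls x)) x.
Proof. exact/sn_clsP/sn_cls_repr. Qed.

Definition sn_quot_le p q := sn_qle (repr p) (repr q).

Lemma sn_quot_le_refl : reflexive sn_quot_le.
Proof. by move=> p; apply: sn_qle_refl. Qed.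

Lemma sn_quot_le_anti : antisymmetric sn_quot_le.
Proof.
by move=> p q pq; rewrite -(sn_cls_repr p) -(sn_cls_repr q); apply/sn_clsP.
Qed.

Lemma sn_quot_le_trans : transitive sn_quot_le.
Proof. by move=> q p r; apply: sn_qle_trans. Qed.

HB.instance Definition _ := Order.Le_isPOrder.Build sn_display sn_quot
  sn_quot_le_refl sn_quot_le_anti sn_quot_le_trans.

Lemma sn_cls_le x y : (sn_cls x <= sn_cls y) = sn_qle x y.
Proof.
have /andP[xx' x'x] := sn_repr_cls x; have /andP[yy' y'y] := sn_repr_cls y.
apply/idP/idP => xy.
  exact: sn_qle_trans (sn_qle_trans x'x xy) yy'.
exact: sn_qle_trans (sn_qle_trans xx' xy) y'y.
Qed.

Definition sn_quot_meet p q := sn_cls (repr p `&` repr q).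
Definition sn_quot_join p q := sn_cls (repr p `|` repr q).

Lemma sn_quot_lexI p q r : (p <= sn_quot_meet q r) = (p <= q) && (p <= r).
Proof. by rewrite -{1}(sn_cls_repr p) sn_cls_le sn_qleI. Qed.

Lemma sn_quot_leUx p q r : (sn_quot_join p q <= r) = (p <= r) && (q <= r).
Proof. by rewrite -{1}(sn_cls_repr r) sn_cls_le sn_qleU. Qed.

HB.instance Definition _ := Order.POrder_isMeetSemilattice.Build sn_display
  sn_quot sn_quot_lexI.
HB.instance Definition _ := Order.POrder_isJoinSemilattice.Build sn_display
  sn_quot sn_quot_leUx.

Lemma sn_quot_le0x p : sn_cls \bot <= p.
Proof. by elim/sn_cls_ind: p => x; rewrite sn_cls_le sn_le_qle ?le0x. Qed.

Lemma sn_quot_lex1 p : p <= sn_cls \top.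
Proof. by elim/sn_cls_ind: p => x; rewrite sn_cls_le sn_le_qle ?lex1. Qed.

HB.instance Definition _ := Order.hasBottom.Build sn_display sn_quot
  sn_quot_le0x.
HB.instance Definition _ := Order.hasTop.Build sn_display sn_quot sn_quot_lex1.

Lemma sn_clsI x y : sn_cls (x `&` y) = sn_cls x `&` sn_cls y.
Proof.
apply/le_anti/andP; split; first by rewrite lexI !sn_cls_le -sn_qleI sn_qle_refl.
rewrite -[leLHS]sn_cls_repr sn_cls_le sn_qleI -!sn_cls_le sn_cls_repr.
by rewrite leIl leIr.
Qed.

Lemma sn_clsU x y : sn_cls (x `|` y) = sn_cls x `|` sn_cls y.
Proof.
apply/le_anti/andP; split; last by rewrite leUx !sn_cls_le -sn_qleU sn_qle_refl.
rewrite -[leRHS]sn_cls_repr sn_cls_le sn_qleU -!sn_cls_le sn_cls_repr.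
by rewrite leUl leUr.
Qed.

Definition sn_quot_imp p q := sn_cls (repr p ⟶ repr q).

Lemma sn_qle_imp_congr x y a b : sn_cls x = sn_cls y -> sn_cls a = sn_cls b ->
  sn_qle (x ⟶ a) (y ⟶ b).
Proof.
move=> /sn_clsP/andP[xy yx] /sn_clsP/andP[ab ba].
apply: (@sn_qle_trans _ (y ⟶ a)); rewrite -[X in sn_qle X _]meet1x.
  by apply: sn_qle_mono_impl; rewrite meet1x.
by apply: sn_qle_mono_impr; rewrite meet1x.
Qed.

Lemma sn_cls_imp x y : sn_cls (x ⟶ y) = sn_quot_imp (sn_cls x) (sn_cls y).
Proof.
by apply/sn_clsP/andP; split; apply: sn_qle_imp_congr; rewrite sn_cls_repr.
Qed.

(** Below [x], the elements [y] and [x ⊓ y] are equivalent, so [x ⟶ y] can be traded for [x ⟶N y],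
    which obeys modus ponens and residuation. *)
Lemma sn_quot_imp_mp p q : p `&` sn_quot_imp p q = p `&` q.
Proof.
elim/sn_cls_ind: p => x; elim/sn_cls_ind: q => y.
rewrite -sn_cls_imp -!sn_clsI.
have x_xyy : sn_qle (x `&` (x `&` y)) y by apply: sn_le_qle; rewrite meetA leIr.
have x_yxy : sn_qle (x `&` y) (x `&` y) by apply: sn_qle_refl.
apply/sn_clsP/andP; split; rewrite sn_qleI sn_le_qle ?leIl //=.
  apply: sn_qle_trans (sn_qle_mp x y); rewrite sn_qleI sn_le_qle ?leIl //=.
  exact: sn_qle_mono_impr.
apply: (@sn_qle_trans _ (x `&` (x ⟶N y : L))); last exact: sn_qle_mono_impr.
by rewrite sn_qleI sn_le_qle ?leIl //= sn_qle_impN sn_le_qle // meetAC leIr.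
Qed.

(** Below [x], meeting either argument with [x] changes nothing; both inequalities pass through
    [x ⊓ y ⟶ z], changing one argument at a time. *)
Lemma sn_quot_imp_meet p q r :
  p `&` sn_quot_imp q r = p `&` sn_quot_imp (p `&` q) (p `&` r).
Proof.
elim/sn_cls_ind: p => x; elim/sn_cls_ind: q => y; elim/sn_cls_ind: r => z.
rewrite -(sn_clsI x y) -(sn_clsI x z) -!sn_cls_imp -!sn_clsI.
have meetl u : sn_qle (x `&` u) (x `&` u) by apply: sn_qle_refl.
have meetr u : sn_qle (x `&` (x `&` u)) u.
  by apply: sn_le_qle; rewrite meetA leIr.
apply/sn_clsP/andP; split; rewrite sn_qleI sn_le_qle ?leIl //=.
  apply: (@sn_qle_trans _ (x `&` (x `&` y ⟶ z : L))).
    by rewrite sn_qleI sn_le_qle ?leIl //=; apply: sn_qle_mono_impl.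
  exact: sn_qle_mono_impr.
apply: (@sn_qle_trans _ (x `&` (x `&` y ⟶ z : L))).
  by rewrite sn_qleI sn_le_qle ?leIl //=; apply: sn_qle_mono_impr.
exact: sn_qle_mono_impl.
Qed.

Lemma sn_quot_impxx p : sn_quot_imp p p = \top.
Proof.
rewrite /sn_quot_imp; congr sn_cls.
by rewrite -[RHS](snimpNxx (repr p)) /snimpN snmeetxx.
Qed.

HB.instance Definition _ := isSemiHeyting.Build sn_display sn_quot
  sn_quot_imp_mp sn_quot_imp_meet sn_quot_impxx.

End Quotient.

(** * Pseudocomplements and dense elements *)

Section Pseudocomplement.
Variables (d : Order.disp_t) (H : semiHeytingType d).
Implicit Types x y : H.

Lemma pseudocompl_disj x : x `&` pseudocompl x = \bot.
Proof. by rewrite shimp_mp meetx0. Qed.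

Lemma le_pseudocompl x y : (y <= pseudocompl x) = (y `&` x <= \bot).
Proof. by rewrite -sh_residuation meetx0. Qed.

(** The pseudocomplement of [w] is disjoint from [x], hence lies below [pseudocompl x] and so below
    [w], from which it is disjoint. *)
Lemma dense_join_pseudocompl x : dense_elements (x `|` pseudocompl x).
Proof.
set w := x `|` _; apply/eqP; rewrite -lex0.
rewrite -(pseudocompl_disj w) lexI lexx andbT.
apply: le_trans (leUr _ _); rewrite le_pseudocompl meetC.
by rewrite -(pseudocompl_disj w) leI2 ?leUl.
Qed.

End Pseudocomplement.

(** * The filter of the quotient and the isomorphism *)

Section Representation.
Variable A : semiNelsonType.
Local Notation L := (sn_lattice A).
Local Notation H := (sn_quot A).
Implicit Types (a x y z : L) (p q r : H).

Lemma sn_cls_disj x : sn_cls x `&` sn_cls (∼ x) = \bot.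
Proof.
by apply/eqP; rewrite -lex0 -sn_clsI [X in is_true X]sn_cls_le sn_qle_kleene.
Qed.

Lemma sn_cls_neg_imp x y : sn_cls (∼ (x ⟶ y)) = sn_cls x `&` sn_cls (∼ y).
Proof. by rewrite -sn_clsI; apply/sn_clsP/sn_neg_imp. Qed.

(** Realises the pair of [[x]] and its pseudocomplement: [∼ (x ⟶ \bot)] has class [[x]], and its
    negation is [x ⟶ \bot]. *)
Lemma sn_cls_neg0 x : sn_cls (∼ (x ⟶ (\bot : L))) = sn_cls x.
Proof. by rewrite sn_cls_neg_imp sn_neg0 meetx1. Qed.

(** The elements with [∼ a <= a] are exactly those of the form [x ⊔ ∼ x]. *)
Definition sn_filter : set H :=
  [set p | exists2 a : L, (∼ a : L) <= a & sn_cls a <= p].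

Lemma sn_filter_le p q : sn_filter p -> p <= q -> sn_filter q.
Proof. by move=> [a aa ap] pq; exists a => //; apply: le_trans ap pq. Qed.

Lemma sn_filter_cls x : sn_filter (sn_cls x `|` sn_cls (∼ x)).
Proof.
exists (x `|` (∼ x : L)); last by rewrite sn_clsU.
by rewrite sn_negU SN3 (le_trans (leIr _ _) (leUl _ _)).
Qed.

Lemma sn_filterI p q : sn_filter p -> sn_filter q -> sn_filter (p `&` q).
Proof.
move=> [a aa ap] [b bb bq]; exists (a `&` b); last by rewrite sn_clsI leI2.
(* Kleene's inequality, since [a ⊓ ∼ a = ∼ a] and [b ⊔ ∼ b = b]. *)
have a_b : (∼ a : L) <= b.
  by have := sn_kleene a b; rewrite (meet_r aa) (join_l bb).
have b_a : (∼ b : L) <= a.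
  by have := sn_kleene b a; rewrite (meet_r bb) (join_l aa).
by rewrite sn_negI leUx !lexI aa bb a_b b_a.
Qed.

(** For [[x]] dense, [x ⟶ \bot] has class [\bot] and its negation has class [[x]], so their join is
    [[x]]. *)
Lemma sn_filter_dense : (@dense_elements _ H `<=` sn_filter)%classic.
Proof.
move=> p; elim/sn_cls_ind: p => x x0.
have := sn_filter_cls (x ⟶ \bot); rewrite sn_cls_neg0.
by rewrite sn_cls_imp [sn_quot_imp _ _]x0 join0x.
Qed.

(* With p = [x], q = [y] and [a] <= p `|` q, where ∼ a <= a, the pair (p, q) is
   the join of (p, p^* ) and (q^*, q) `&` (0, [a]). *)
Lemma sn_filter_pair p q : p `&` q = \bot -> sn_filter (p `|` q) ->
  exists z, sn_cls z = p /\ sn_cls (∼ z) = q.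
Proof.
elim/sn_cls_ind: p => x; elim/sn_cls_ind: q => y xy0 [a aa axy].
pose nx : L := x ⟶ (\bot : L); pose ny : L := y ⟶ (\bot : L).
have clsNa : sn_cls (∼ a) = \bot.
  by apply/eqP; rewrite -lex0 [X in is_true X]sn_cls_le sn_qle_neg0.
have clsNnx : sn_cls (∼ nx) = sn_cls x := sn_cls_neg0 x.
have clsNny : sn_cls (∼ ny) = sn_cls y := sn_cls_neg0 y.
have clsnx : sn_cls nx = pseudocompl (sn_cls x) by rewrite /nx sn_cls_imp.
exists ((∼ nx : L) `|` (ny `&` (∼ a : L))); split.
  by rewrite sn_clsU sn_clsI clsNa meetx0 joinx0.
rewrite sn_negU sn_negI !SN3 sn_clsI sn_clsU clsnx clsNny.
apply/le_anti/andP; split; last first.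
  by rewrite lexI leUl andbT le_pseudocompl meetC xy0.
rewrite sh_meetUr leUx leIr /=.
apply: le_trans (leI2 (lexx _) axy) _.
by rewrite sh_meetU_disj ?leIr // meetC pseudocompl_disj.
Qed.

Lemma sn_filter_ifilter : is_ifilter sn_filter.
Proof.
split; first split.
- by exists (sn_cls \bot `|` sn_cls (∼ (\bot : L))); apply: sn_filter_cls.
- exact: sn_filterI.
- exact: sn_filter_le.
- exact: sn_filter_dense.
move=> p q Fpq r.
have pq0 : p `&` (q `&` pseudocompl p) = \bot.
  by rewrite meetCA pseudocompl_disj meetx0.
have [z [zp zq]] : exists z, sn_cls z = p /\ sn_cls (∼ z) = q `&` pseudocompl p.
  apply: sn_filter_pair => //; rewrite sh_joinIr; apply: sn_filterI => //.
  exact/sn_filter_dense/dense_join_pseudocompl.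
elim/sn_cls_ind: r => x.
(* The generator coming from [x ⟶ z] has class [([x] ⇒ p) ⊔ ([x] ⊓ q ⊓ pseudocompl p)], already
   below the required element. *)
apply: sn_filter_le (sn_filter_cls (x ⟶ z)) _.
by rewrite sn_cls_neg_imp sn_cls_imp zp zq leU2 // leI2 ?leIl.
Qed.

Definition sn_ifilter : ifilter H := IFilter sn_filter_ifilter.

Lemma sn_repr_subproof (x : A) :
  nelson_set sn_ifilter (sn_cls x, sn_cls (∼ x : L)).
Proof. by split; [apply: sn_cls_disj | apply: sn_filter_cls]. Qed.

Definition sn_representation (x : A) : nelson_alg sn_ifilter :=
  SigSub (mem_set (sn_repr_subproof x)).

Lemma sn_representation_morphism : sn_morphism sn_representation.
Proof.
split=> [x y|x y|x y|x|]; apply: nelson_eq => /=.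
- exact: sn_clsI.
- by rewrite SN4; apply: sn_clsU.
- exact: sn_clsU.
- by rewrite snnegU; apply: sn_clsI.
- exact: sn_cls_imp.
- exact: sn_cls_neg_imp.
- by [].
- by rewrite SN3.
- by [].
- by [].
Qed.

Lemma sn_representation_inj : injective sn_representation.
Proof.
move=> x y /(congr1 val) [] /sn_clsP/andP[xy yx] /sn_clsP/andP[nxy nyx].
by apply: (@le_anti _ L); rewrite !sn_le_of_qle.
Qed.

Lemma sn_representation_bij : bijective sn_representation.
Proof.
have /choice[g gK] : forall u, exists x, sn_representation x = u.
  move=> u; have [disj Fu] := set_valP u.
  have [x [x1 x2]] := sn_filter_pair disj Fu.
  by exists x; apply: nelson_eq.
by exists g => // x; apply: sn_representation_inj; rewrite gK.
Qed.

End Representation.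

Theorem theorem3p6 (A : semiNelsonType) :
  exists (d : Order.disp_t) (H : semiHeytingType d) (F : ifilter H),
    sn_isomorphic A (nelson_alg F).
Proof.
exists sn_display, (sn_quot A), (sn_ifilter A), (@sn_representation A).
  exact: sn_representation_morphism.
exact: sn_representation_bij.
Qed.
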